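(* Let $t,k\ge 2$ and consider a chordal $(t,k)$-coloring of the complete graph $K_n$. Then there is a strong cover of a set of at least $\frac{k-1}{k+1}n$ vertices of $K_n$; that is, there are sets $W_1,\dots,W_t\subseteq V(K_n)$ (possibly empty) such that each $W_i$ is a clique of color $i$ and $|W_1\cup\dots\cup W_t|\ge \frac{k-1}{k+1}n$.
   Context: A $t$-coloring of $K_n$ is a representation of its edge set as a union $E(G_1)\cup\dots\cup E(G_t)$ of edge sets of $t$ graphs $G_1,\dots,G_t$ on $V(K_n)$; an edge may receive several colors (it has color $i$ if it is an edge of $G_i$). A clique of color $i$ is a vertex set spanning a complete subgraph of $G_i$. A $(t,k)$-coloring is a $t$-coloring in which every set of $k$ vertices (the whole vertex set if $n<k$) spans a clique of some color. It is chordal if every $G_i$ is chordal (has no induced cycle of length at least $4$). A strong cover of a vertex set $U$ is a covering of $U$ by monochromatic cliques of pairwise different colors. *)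

(* Defs.v *)
From mathcomp Require Import all_boot all_order all_algebra.
Set Implicit Arguments.
Unset Strict Implicit.
Unset Printing Implicit Defensive.

Record sgraph (V : finType) := SGraph {
  adj :> rel V;
  adj_sym : symmetric adj;
  adj_irrefl : irreflexive adj
}.

Definition clique (V : finType) (G : sgraph V) (A : {set V}) : Prop :=
  {in A &, forall x y, x != y -> G x y}.

(* The vertices of the cycle are listed in cyclic order in c. *)
Definition induced_cycle (V : finType) (G : sgraph V) (c : seq V) : Prop :=
  ucycle G c /\ {in c &, forall x y, G x y -> (y == next c x) || (x == next c y)}.

Definition chordal (V : finType) (G : sgraph V) : Prop :=
  forall c : seq V, induced_cycle G c -> size c < 4.

Definition coloring (V : finType) (t : nat) (G : 'I_t -> sgraph V) : Prop :=
  forall x y : V, x != y -> exists i : 'I_t, G i x y.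

(* The minimum accounts for complete graphs with fewer than k vertices, where
   the whole vertex set is required to be a clique of some color. *)
Definition tk_coloring (V : finType) (t k : nat) (G : 'I_t -> sgraph V) : Prop :=
  coloring G /\
  forall A : {set V}, #|A| = minn k #|V| -> exists i : 'I_t, clique (G i) A.

(* Main.v *)
(* Take cliques W_i, one per color, covering as many vertices as possible, and
   let U be the uncovered set. A vertex of U has in each color i a non-neighbor
   in W_i, since otherwise it could be added to W_i. Hence two vertices x, y of U
   are joined in at least k - 1 colors: otherwise x, y and one non-neighbor of x
   in W_i for each color i of xy would be at most k vertices in no common clique.
   On the other hand a clique of color i inside U is no larger than the private
   part P_i of W_i, for which it could be exchanged; since the chordal graph
   G_i[U] has a simplicial vertex, and so on inductively, it has at most
   |P_i|(|U| - 1) edges. The P_i are disjoint and avoid U, so counting edges of U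
   with multiplicity gives (k - 1)|U|/2 <= sum |P_i| <= n - |U|. *)
Require Import Defs.
From mathcomp Require Import all_boot all_order all_algebra.
From mathcomp Require Import zify.
Import Order.TTheory GRing.Theory Num.Theory.

Set Implicit Arguments.
Unset Strict Implicit.
Unset Printing Implicit Defensive.

(** * Chordal graphs: simplicial vertices and a bound on the number of edges *)

Section Chordal.
Local Open Scope nat_scope.
Variables (V : finType) (G : sgraph V).

Lemma cliqueP (A : {set V}) :
  reflect (clique G A) [forall x in A, forall y in A, (x != y) ==> G x y].
Proof.
apply: (iffP forall_inP) => [H x y xA yA xy|H x xA].
  by move/forall_inP: (H x xA) => /(_ y yA) /implyP; apply.
by apply/forall_inP => y yA; apply/implyP; apply: H.
Qed.

(** Index [j] of [rcons q b] is position [j.+1] of the whole path, so the chord bypasses exactly the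
    vertices of [q] with index from [i] up to, but excluding, [j]. *)
Lemma path_shortcut (a b : V) (q : seq V) (i j : nat) :
  path G a (rcons q b) -> i <= j <= size q ->
  G (nth a (a :: q) i) (nth a (rcons q b) j) ->
  path G a (rcons (take i q ++ drop j q) b).
Proof.
move=> pq /andP[ij js] Gij.
have ji : i <= size q by apply: leq_trans js.
have jr : j < size (rcons q b) by rewrite size_rcons ltnS.
have Eb : rcons (drop j q) b = drop j (rcons q b) by rewrite drop_rcons.
have : path G a (take j (rcons q b) ++ drop j (rcons q b)) by rewrite cat_take_drop.
rewrite cat_path (drop_nth a jr) /= => /and3P[_ _ pd].
rewrite rcons_cat cat_path Eb (drop_nth a jr) /= pd andbT.
move: pq; rewrite -{1}(cat_take_drop i q) rcons_cat cat_path => /andP[-> _] /=.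
suff -> : last a (take i q) = nth a (a :: q) i by [].
case: i ij Gij ji => [|i] _ _ ji; first by rewrite take0.
by rewrite (last_nth a) size_takel //= nth_take.
Qed.

(** Suppose [a] and [b] are non-adjacent. A chord of the path gives a shorter path, to which
    induction applies; without chords, [v] closes the path up into an induced cycle of length at
    least 4. *)
Lemma chordal_detour (v a b : V) (q : seq V) :
  chordal G -> G v a -> G v b -> a != b -> path G a (rcons q b) -> uniq q ->
  {in q, forall x, x != v /\ ~~ G v x} -> G a b.
Proof.
move=> chG Gva Gvb ab.
have [m] := ubnP (size q); elim: m q => // m IH q sq pq uq qv.
apply: contraT => nGab.
pose l := a :: rcons q b; pose c := v :: l.
have sl : size l = (size q).+2 by rewrite /= size_rcons.
have q0 : 0 < size q by case: (q) pq => //=; rewrite andbT (negPf nGab).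
have chord i j : i.+1 < j < size l -> ~~ G (nth a l i) (nth a l j).
  case: j => [|j]; first by rewrite ltn0.
  rewrite sl !ltnS => /andP[ij jq]; apply/negP => Gij.
  have : G a b; last by apply/negP.
  apply: (IH (take i q ++ drop j q)).
  - rewrite size_cat size_drop size_takel; lia.
  - apply: path_shortcut => //; first by rewrite jq ltnW.
    by move: Gij; rewrite /l /= -rcons_cons nth_rcons /= ltnS (leq_trans (ltnW ij)).
  - apply: (subseq_uniq _ uq).
    rewrite -[X in subseq _ X](cat_take_drop i q); apply: cat_subseq => //.
    have -> : j = (j - i) + i by lia.
    by rewrite -drop_drop; apply: drop_subseq.
  - by move=> x; rewrite mem_cat => /orP[/mem_take|/mem_drop]; apply: qv.
have va : v != a by apply: contraL Gva => /eqP ->; rewrite adj_irrefl.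
have vb : v != b by apply: contraL Gvb => /eqP ->; rewrite adj_irrefl.
have uc : uniq c.
  rewrite /= mem_rcons !inE mem_rcons inE rcons_uniq uq (negPf va) (negPf vb) (negPf ab) /=.
  by rewrite andbT; apply/and3P; split; apply/negP => /qv [] //;
     rewrite ?eqxx ?Gva ?Gvb.
suff : size c < 4 by rewrite /c /= size_rcons; lia.
apply: chG; split.
  by rewrite /ucycle uc andbT /= Gva rcons_path pq last_rcons adj_sym.
suff key i j : i < j < size c -> G (nth a c i) (nth a c j) ->
    (nth a c j == next c (nth a c i)) || (nth a c i == next c (nth a c j)).
  move=> x y xc yc Gxy; have [ij|ij|E] := ltngtP (index x c) (index y c).
  - by have := key (index x c) (index y c); rewrite ij index_mem !nth_index //; apply.
  - have := key (index y c) (index x c); rewrite ij index_mem !nth_index //.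
    by rewrite orbC adj_sym; apply.
  - by move: Gxy; rewrite -(nth_index a xc) E nth_index ?adj_irrefl.
move=> /andP[ij js] Gij.
(* The default [v] encodes the wrap-around: the successor of the last vertex of [c] is [v]. *)
have nextE h : h < size c -> next c (nth a c h) = nth v l h.
  by move=> hs; rewrite next_nth mem_nth // index_uniq.
rewrite !nextE ?(ltn_trans ij) //.
have sc : size c = (size l).+1 by [].
rewrite sc in js.
have [/eqP E|nE] := boolP (j == i.+1).
  by rewrite E /= (set_nth_default v) ?eqxx //; lia.
(* Position 0 is [v], whose only neighbors on [c] are [a] and [b]. *)
case: i => [|i] in ij Gij nE *.
  have [js1|js1] := leqP (size l) j.
    by rewrite [X in _ || (_ == X)]nth_default ?eqxx ?orbT.
  case: j => [|[|j]] // in ij js Gij nE js1 *.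
  move: Gij js1; rewrite /= size_rcons => Gij js1.
  have jq : j < size q by lia.
  move: Gij; rewrite nth_rcons jq => Gij.
  by case: (qv (nth a q j) (mem_nth _ jq)); rewrite Gij.
case: j => // j in ij js Gij nE *.
suff : ~~ G (nth a l i) (nth a l j) by rewrite Gij.
by apply: chord; move: js; rewrite /c /=; lia.
Qed.

Definition simplicial (U : {set V}) (w : V) := clique G [set x in U | (x == w) || G w x].

(* Dirac's argument. Let C be the component of d outside the closed neighborhood
   of v. Its attachment set S lies in N(v) and is a clique, as an induced path
   through C between two non-adjacent vertices of S would close up at v into a
   long induced cycle. By induction C :|: S, which misses v, has a simplicial
   vertex in C, and it remains simplicial in U. *)
Lemma chordal_simplicial_nonadj (U : {set V}) (v d : V) :
  chordal G -> v \in U -> d \in U -> d != v -> ~~ G v d ->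
  exists w, [/\ w \in U, w != v, ~~ G v w & simplicial U w].
Proof.
move=> chG; have [m] := ubnP #|U|; elim: m U v d => // m IH U v d sU vU dU dv nvd.
pose D := [set x in U | (x != v) && ~~ G v x].
have dD : d \in D by rewrite inE dU dv.
pose e := [rel x y | [&& x \in D, y \in D & G x y]].
pose C := [set x | connect e d x].
have CD x : x \in C -> x \in D.
  rewrite inE => /connectP[p]; case/lastP: p => [_ ->//|p y].
  by rewrite rcons_path last_rcons => /andP[_ /and3P[_ ? _]] ->.
have esym : symmetric e by move=> x y; rewrite /= adj_sym andbCA.
pose S := [set s in U | (s \notin C) && [exists c in C, G s c]].
have SN s : s \in S -> G v s.
  rewrite inE => /and3P[sU' sC /exists_inP[c cC Gsc]].
  have cD := CD c cC.
  have sv : s != v.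
    apply: contraTneq Gsc => ->; by move: cD; rewrite inE => /and3P[].
  apply: contraNT sC => nvs; rewrite inE.
  move: (cC); rewrite inE => /connect_trans; apply.
  by apply: connect1; rewrite /= cD inE sU' sv nvs adj_sym Gsc.
have Sclique : clique G S.
  move=> a b aS bS ab.
  have [Gva Gvb] := (SN a aS, SN b bS).
  move: aS bS; rewrite !inE => /and3P[aU aC /exists_inP[c1 c1C Ga1]].
  move=> /and3P[bU bC /exists_inP[c2 c2C Gb2]].
  have : connect e c1 c2.
    move: c1C c2C; rewrite !inE => h1 h2; apply: connect_trans h2.
    by rewrite (sym_connect_sym esym).
  case/connectP => p0 pp0 E0.
  case/shortenP: pp0 E0 => p pp up _ E.
  apply: (@chordal_detour v a b (c1 :: p)) => //.
  - rewrite /= Ga1 rcons_path -E adj_sym Gb2 andbT.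
    by apply: sub_path pp => x y /and3P[].
  - move=> x xp; suff : x \in D by rewrite inE => /and3P[].
    move: xp; rewrite inE => /orP[/eqP ->|xp]; first exact: CD.
    by elim: p (c1) pp xp {up E} => //= y p IHp z /andP[/and3P[_ yD _] /IHp H];
       rewrite inE => /orP[/eqP ->|].
pose U' := C :|: S.
have CU x : x \in C -> x \in U by move/CD; rewrite inE => /and3P[].
have sU' : #|U'| < m.
  apply: (@leq_trans #|U|); last by rewrite -ltnS.
  apply: proper_card; apply/properP; split.
    by apply/subsetP => x; rewrite inE => /orP[/CU|] //; rewrite inE => /and3P[].
  exists v => //; rewrite inE negb_or; apply/andP; split.
    by apply/negP => /CD; rewrite inE eqxx andbF.
  by apply/negP => /SN; rewrite adj_irrefl.
suff [w wC sw] : exists2 w, w \in C & simplicial U' w.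
  exists w; move: (CD w wC); rewrite inE => /and3P[wU wv nvw]; split => //.
  (* A neighbor in [U] of a vertex of [C] lies in [C] or is attached to it, hence in [S]; so [w] has
     the same closed neighborhood in [U'] as in [U]. *)
  rewrite /simplicial; suff -> : [set x in U | (x == w) || G w x] =
      [set x in U' | (x == w) || G w x] by [].
  apply/setP => x; rewrite [in LHS]inE [in RHS]inE.
  apply/andP/andP => -[h1 h2]; split => //; last first.
    by case/setUP: h1 => [/CU|] //; rewrite inE => /andP[].
  case/orP: h2 => [/eqP ->|Gwx]; first by rewrite in_setU wC.
  rewrite in_setU; have [//|xC /=] := boolP (x \in C); rewrite inE h1 xC /=.
  by apply/exists_inP; exists w; rewrite // adj_sym.
have nonadj s : s \in U' -> ~~ [forall x in U', (x != s) ==> G s x] ->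
    exists w, [/\ w \in U', w != s, ~~ G s w & simplicial U' w].
  move=> sU2 /forall_inPn[x xU']; rewrite negb_imply => /andP[xs nG].
  exact: (IH U' s x).
(* If some [s] in [S] misses a vertex of [U'], induction gives a simplicial vertex not adjacent to
   [s]; it lies in [C] because [S] is a clique. *)
have [/existsP[s /andP[sS /nonadj H]]|/existsPn Sdom] :=
    boolP [exists s, (s \in S) && ~~ [forall x in U', (x != s) ==> G s x]].
  case: H => [|w [wU' ws nsw sw]]; first by rewrite inE sS orbT.
  exists w => //; move: wU'; rewrite inE => /orP[//|wS].
  by move: nsw; rewrite Sclique // eq_sym.
have dC : d \in C by rewrite inE.
have [/cliqueP cU'|] := boolP [forall x in U', forall y in U', (x != y) ==> G x y].
  by exists d => // x y /setIdP[xU' _] /setIdP[yU' _]; apply: cU'.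
(* Every vertex of [S] is now adjacent to all the rest of [U'], so a simplicial vertex not adjacent
   to [c] must lie in [C]. *)
case/forall_inPn => c cU' /forall_inPn[y yU']; rewrite negb_imply => /andP[cy ncy].
case: (nonadj c cU') => [|w [wU' wc ncw sw]].
  by apply/forall_inPn; exists y => //; rewrite negb_imply eq_sym cy.
exists w => //; move: wU'; rewrite inE => /orP[//|wS].
move: (Sdom w); rewrite wS /= negbK => /forall_inP /(_ c cU').
by rewrite eq_sym wc adj_sym (negPf ncw).
Qed.

Lemma chordal_simplicial (U : {set V}) :
  chordal G -> U != set0 -> exists2 w, w \in U & simplicial U w.
Proof.
move=> chG /set0Pn[v vU].
have [/cliqueP cU|] := boolP [forall x in U, forall y in U, (x != y) ==> G x y].
  exists v => // x y; rewrite !inE => /andP[xU _] /andP[yU _]; exact: cU.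
case/forall_inPn => c cU /forall_inPn[y yU]; rewrite negb_imply eq_sym => /andP[cy ncy].
by have [w [? _ _ ?]] := chordal_simplicial_nonadj chG cU yU cy ncy; exists w.
Qed.

(* The left side counts every edge twice. *)
Lemma chordal_edge_bound (U : {set V}) (p : nat) :
  chordal G -> (forall A : {set V}, A \subset U -> clique G A -> #|A| <= p) ->
  \sum_(x in U) \sum_(y in U) G x y <= p.*2 * #|U|.-1.
Proof.
move=> chG; have [m] := ubnP #|U|; elim: m U => // m IH U sU cl.
have [->|U0] := eqVneq U set0; first by rewrite big_set0.
have [w wU sw] := chordal_simplicial chG U0.
pose U' := U :\ w.
have cU : #|U| = #|U'|.+1 by rewrite (cardsD1 w) wU.
have deg : \sum_(y in U') G w y <= p.
  rewrite -big_mkcondr sum1_card /=.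
  apply: leq_trans (cl _ _ sw); last by apply/subsetP => x /setIdP[].
  apply: subset_leq_card; apply/subsetP => x.
  by rewrite inE unfold_in => /andP[/setD1P[_ ->] ->]; rewrite orbT.
have sum_split (f : V -> nat) : \sum_(x in U) f x = f w + \sum_(x in U') f x.
  rewrite (bigD1 w) //=; congr (_ + _); apply: eq_bigl => x.
  by rewrite !inE andbC.
rewrite sum_split [X in _ + X](eq_bigr (fun x => G x w + \sum_(y in U') G x y)); last first.
  by move=> x _; rewrite sum_split.
rewrite sum_split adj_irrefl big_split /=.
have -> : \sum_(x in U') G x w = \sum_(y in U') G w y.
  by apply: eq_bigr => x _; rewrite adj_sym.
(* The last remaining vertex contributes no edge, whence the factor [#|U|.-1] instead of [#|U|]. *)
have [U'0|U'0] := posnP #|U'|.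
  by move/eqP: U'0; rewrite cards_eq0 => /eqP ->; rewrite !big_set0.
have /IH H : #|U'| < m by rewrite -ltnS -cU.
have {}H := H (fun A sA => cl A (subset_trans sA (subD1set U w))).
rewrite cU /=; move: H deg U'0; move: (\sum_(y in U') G w y) (bigop _ _ _) => a b.
by case: #|U'| => // u; rewrite [_.+1.-1]/=; nia.
Qed.

End Chordal.

(** Serves to pad a small set to exactly the size for which a [(t,k)]-coloring guarantees a
    clique. *)
Lemma superset_of_card (V : finType) (A : {set V}) (m : nat) :
  (#|A| <= m <= #|V|)%N -> exists2 B : {set V}, A \subset B & #|B| = m.
Proof.
case/andP=> Am mV; rewrite -(subnKC Am) in mV *.
elim: (m - #|A|)%N mV => [|d IH] dV; first by exists A; rewrite ?addn0.
have [|B AB cB] := IH; first by apply: leq_trans dV; rewrite leq_add2l.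
have /set0Pn[x] : ~: B != set0.
  by rewrite -card_gt0 cardsCs setCK cB subn_gt0; move: dV; rewrite addnS.
rewrite inE => xB; exists (x |: B); first exact: subset_trans AB (subsetUr _ _).
by rewrite cardsU1 xB cB addnS.
Qed.

(** * Maximum strong covers and the vertices they miss *)

Section StrongCover.
Local Open Scope nat_scope.
Variables (V : finType) (t k : nat) (G : 'I_t -> sgraph V).

Lemma max_strong_cover : exists2 W : 'I_t -> {set V},
  forall i, clique (G i) (W i) &
  forall W' : 'I_t -> {set V}, (forall i, clique (G i) (W' i)) ->
    #|\bigcup_i W' i| <= #|\bigcup_i W i|.
Proof.
(* Families are encoded as finite functions, a finite type on which a maximum is attained. *)
pose P (W : {ffun 'I_t -> {set V}}) :=
  [forall i, [forall x in W i, forall y in W i, (x != y) ==> G i x y]].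
have P0 : P [ffun => set0].
  by apply/forallP => i; apply/cliqueP => x; rewrite ffunE inE.
have [W /forallP PW Wmax] := arg_maxnP (fun W : {ffun 'I_t -> {set V}} => #|\bigcup_i W i|) P0.
exists W => [i|W' clW']; first exact/cliqueP.
rewrite -(eq_bigr W' (fun i _ => ffunE W' i)); apply: Wmax.
by apply/forallP => i; rewrite ffunE; apply/cliqueP.
Qed.

Variable W : 'I_t -> {set V}.
Hypothesis clW : forall i, clique (G i) (W i).
Hypothesis maxW : forall W' : 'I_t -> {set V}, (forall i, clique (G i) (W' i)) ->
    #|\bigcup_i W' i| <= #|\bigcup_i W i|.

Let U := ~: \bigcup_i W i.
Let priv i := W i :\: \bigcup_(j | j != i) W j.

(** Replacing [W i] by [A] yields a competing family of cliques. *)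
Lemma max_cover_swap i (A : {set V}) :
  clique (G i) A -> #|A :|: \bigcup_(j | j != i) W j| <= #|\bigcup_j W j|.
Proof.
move=> clA; pose W' j := if j == i then A else W j.
suff <- : \bigcup_j W' j = A :|: \bigcup_(j | j != i) W j.
  by apply: maxW => j; rewrite /W'; case: eqP => [->|_].
rewrite (bigD1 i) //= /W' eqxx; congr (_ :|: _).
by apply: eq_bigr => j /negPf ->.
Qed.

Lemma uncovered_notin x i : x \in U -> x \notin W i.
Proof. by rewrite inE; apply: contra => xi; apply/bigcupP; exists i. Qed.

Lemma uncovered_clique_bound i (A : {set V}) :
  A \subset U -> clique (G i) A -> #|A| <= #|priv i|.
Proof.
move=> AU /max_cover_swap; set R := \bigcup_(j | j != i) W j.
have -> : \bigcup_j W j = priv i :|: R.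
  rewrite (bigD1 i) //= -/R; apply/setP => x; rewrite !inE.
  by case: (x \in R); rewrite ?orbT ?orbF.
(* Both [A] and [priv i] are disjoint from [R], so [#|R|] cancels. *)
have AR : [disjoint A & R].
  rewrite disjoints_subset; apply: subset_trans AU _; rewrite setCS.
  by apply/bigcupsP => j _; apply: bigcup_sup.
have PR : [disjoint priv i & R] by rewrite disjoints_subset subsetDr.
by rewrite !cardsU (disjoint_setI0 AR) (disjoint_setI0 PR) cards0 !subn0 leq_add2r.
Qed.

Lemma uncovered_nonneighbor x i : x \in U -> exists s, (s \in W i) && ~~ G i x s.
Proof.
move=> xU; apply/existsP; apply: contraT => /exists_inPn adjx.
have clA : clique (G i) (x |: W i).
  move=> y z; rewrite !inE => /orP[/eqP ->|yW] /orP[/eqP ->|zW].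
  - by rewrite eqxx.
  - by move=> _; apply: contraNT (adjx z zW).
  - by move=> _; rewrite adj_sym; apply: contraNT (adjx y yW).
  - exact: clW.
have := max_cover_swap clA; rewrite -setUA.
rewrite (_ : W i :|: _ = \bigcup_j W j) ?cardsU1; last by rewrite [RHS](bigD1 i).
by move: (xU); rewrite inE => ->; rewrite add1n ltnn.
Qed.

Hypothesis hk : 2 <= k.
Hypothesis hG : tk_coloring k G.

Lemma uncovered_pair_colors x y :
  x \in U -> y \in U -> x != y -> k.-1 <= #|[set i | G i x y]|.
Proof.
move=> xU yU xy; rewrite leqNgt; apply/negP => few.
have [s sP] := fin_all_exists (fun i => uncovered_nonneighbor i xU).
pose A := x |: (y |: s @: [set i | G i x y]).
(* Fewer than [k.-1] shared colors give at most [k - 2] non-neighbors besides [x] and [y]. *)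
have cA : #|A| <= minn k #|V|.
  rewrite leq_min max_card andbT.
  apply: leq_trans (_ : (#|[set i | G i x y]|).+2 <= _); last by lia.
  by rewrite /A !cardsU1; apply: leq_add (leq_b1 _) (leq_add (leq_b1 _) (leq_imset_card _ _)).
have [|B AB cB] := @superset_of_card V A (minn k #|V|); first by rewrite cA geq_minr.
have [_ /(_ B cB) [i clB]] := hG.
have Bx : x \in B by apply: (subsetP AB); rewrite !inE eqxx.
have By : y \in B by apply: (subsetP AB); rewrite !inE eqxx orbT.
have Gxy := clB x y Bx By xy.
(* The color [i] of the clique [B] is a color of [xy], so [B] contains the non-neighbor [s i] of
   [x]. *)
have Bs : s i \in B.
  by apply: (subsetP AB); rewrite !inE imset_f ?orbT // inE.
have /andP[sW /negP[]] := sP i; apply: clB => //.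
by apply: contraTneq sW => <-; apply: uncovered_notin.
Qed.

Hypothesis chG : forall i, chordal (G i).

Lemma uncovered_card_bound : k.-1 * #|U| <= 2 * #|\bigcup_i W i|.
Proof.
(* The factor [#|U|.-1] is cancelled at the end, so [#|U| <= 1] is treated first. With one uncovered
   [x], the case [#|V| <= k] would make [V] a clique of some color [i], although [x] has a
   non-neighbor in [W i]. *)
have [|U2] := leqP #|U| 1.
  rewrite leq_eqVlt ltnS leqn0 => /orP[U1|/eqP -> ]; last by rewrite muln0.
  have kV : k < #|V|.
    rewrite ltnNge; apply/negP => Vk.
    have [_ /(_ setT)] := hG; rewrite cardsT => /(_ _)[|i clT].
      by rewrite (minn_idPr Vk).
    have /card_gt0P[x xU] : 0 < #|U| by rewrite (eqP U1).
    have [s /andP[sW /negP[]]] := uncovered_nonneighbor i xU.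
    apply: clT; rewrite ?inE //.
    by apply: contraTneq sW => <-; apply: uncovered_notin.
  by have := cardsC (\bigcup_i W i); rewrite -/U (eqP U1); lia.
have sum_priv : \sum_i #|priv i| <= #|\bigcup_i W i|.
  have triv i j : i != j -> [disjoint priv i & priv j].
    move=> ij; apply/pred0P => x /=; apply/negP => /andP[].
    rewrite inE => /andP[/bigcupP nx _]; rewrite inE => /andP[_ xj].
    by apply: nx; exists j; rewrite // eq_sym.
  rewrite -sum1_card.
  rewrite (eq_bigr (fun i => \sum_(x in \bigcup_i W i) (x \in priv i))); last first.
    move=> i _; rewrite -big_mkcondr sum1_card; apply: eq_card => x.
    rewrite [RHS]inE andbC; case: (boolP (x \in priv i)) => //.
    by rewrite inE => /andP[_ xi]; apply/esym/bigcupP; exists i.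
  (* Each covered vertex lies in at most one private part. *)
  rewrite exchange_big; apply: leq_sum => x _ /=.
  rewrite -big_mkcond sum1dep_card.
  apply/card_le1P => i; rewrite in_set => ix j; rewrite in_set.
  apply/idP/eqP => [jx|->//].
  by have [//|/triv ji] := eqVneq j i; rewrite (disjointFr ji jx) in ix.
have upper : \sum_i \sum_(x in U) \sum_(y in U) G i x y
    <= \sum_i (#|priv i|).*2 * #|U|.-1.
  apply: leq_sum => i _; apply: chordal_edge_bound => // A.
  exact: uncovered_clique_bound.
(* Each ordered pair of distinct uncovered vertices is counted at least [k.-1] times. *)
have lower : #|U| * (#|U|.-1 * k.-1) <= \sum_i \sum_(x in U) \sum_(y in U) G i x y.
  rewrite exchange_big -sum_nat_const; apply: leq_sum => x xU /=.
  rewrite exchange_big (bigD1 x) //=.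
  have -> : #|U|.-1 = #|U :\ x| by rewrite (cardsD1 x U) xU.
  rewrite -sum_nat_const; apply: leq_trans (leq_addl _ _).
  rewrite (eq_bigl (fun y => (y \in U) && (y != x))); last first.
    by move=> y; rewrite !inE andbC.
  apply: leq_sum => y /andP[yU yx].
  rewrite -big_mkcond sum1dep_card.
  by apply: uncovered_pair_colors; rewrite // eq_sym.
move: (leq_trans lower upper) => {lower upper}.
rewrite -big_distrl /= -(eq_bigr _ (fun i _ => mul2n _)) -big_distrr /=.
move: sum_priv U2; move: (\sum_i _) => p; move: #|U| => [|[|u]] //= H _.
rewrite mulnCA mulnC leq_pmul2r //; lia.
Qed.

End StrongCover.

(** * The bound as a fraction of all vertices *)

Local Open Scope ring_scope.

Theorem theorem1p5 (t k n : nat) (ht : (2 <= t)%N) (hk : (2 <= k)%N)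
    (V : finType) (hV : #|V| = n) (G : 'I_t -> sgraph V)
    (hG : tk_coloring k G) (hchordal : forall i : 'I_t, chordal (G i)) :
  exists W : 'I_t -> {set V},
    (forall i : 'I_t, clique (G i) (W i)) /\
    (k%:R - 1) / (k%:R + 1) * n%:R <= #|\bigcup_i W i|%:R :> rat.
Proof.
have [W clW maxW] := max_strong_cover G; exists W; split=> //.
have := uncovered_card_bound clW maxW hk hG hchordal.
have := cardsC (\bigcup_i W i); rewrite hV => En bound.
(* With [w] covered and [u] uncovered vertices, clearing the denominator leaves
   [(k - 1)(w + u) <= (k + 1)w], that is, [(k - 1)u <= 2w]. *)
case: k hk {hG} bound => // k' _ /= bound.
rewrite mulrAC ler_pdivrMr -natr1 ?addrK; last by rewrite ltr_wpDl ?addr_ge0.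
rewrite !natr1 -!natrM ler_nat -En mulnDr mulnC -addn2 mulnDr leq_add2l.
by rewrite [X in (_ <= X)%N]mulnC.
Qed.
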